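(* Let $L$ be a set of $n$ links with a fixed power assignment, and suppose every link of $L$ runs the algorithm Distributed (described in the context), stopping as soon as it learns (via acknowledgement) that its transmission succeeded. Then, with high probability, every link of $L$ has successfully transmitted by time $O(\Lambda(L)\log n)$.
   Context: A link $\ell_v$ is a pair (sender $s_v$, receiver $r_v$) in a metric space with distance $d$; its length is $\ell_v=d(s_v,r_v)$, $d_{wv}=d(s_w,r_v)$, and $P_v$ is its power. Parameters $\alpha>0,\beta\ge1$, noise $N\ge 0$. The affectance of $\ell_w$ on $\ell_v$ is $a_w(v)=\min\{1, c_v\frac{P_w}{P_v}(\ell_v/d_{wv})^\alpha\}$ with $c_v=\beta/(1-\beta N\ell_v^\alpha/P_v)$, and $a_v(v)=0$. For a set $S$ of links, $a_S(v)=\sum_{\ell_w\in S}a_w(v)$. A link $\ell_v$ transmitting in a slot succeeds iff $a_S(v)\le1$ where $S$ is the set of links transmitting in that slot. The measure $\Lambda(L)$ is the smallest $t$ such that for every $R\subseteq L$, $|\{\ell\in R: a_R(\ell)\le 4t\}|\ge |R|/4$. Algorithm Distributed (run by each sender, $c_3$ a sufficiently large constant): set $k=0$; while the transmission has not been successful: set $q=\frac{1}{4\cdot 2^k}$; for $\frac{8c_3\ln n}{q}$ slots, transmit in each slot independently with probability $q$; then increase $k$ by 1.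
   Formalization: The time bound is O(max(1, Λ(L)) log n), since with real t the measure Λ(L) can be arbitrarily near 0 (two very distant links) and the unclamped bound is then under one slot; powers and the noise margin 1−βNℓ_v^α/P_v are assumed positive, so that c_v is a positive constant. *)

(* Defs.v *)
From HB Require Import structures.
From mathcomp Require Import all_boot all_order all_algebra.
From mathcomp Require Import all_classical all_reals all_analysis.

Set Implicit Arguments.
Unset Strict Implicit.
Unset Printing Implicit Defensive.

Import Order.TTheory GRing.Theory Num.Theory.

Local Open Scope ring_scope.

Record link (R : realType) (X : metricType R) := Link {
  sender : X;
  receiver : X;
  power : R }.

Section Affectance.
Context {R : realType} {X : metricType R} {V : finType}.
Variables (alpha beta N : R) (L : V -> link X).

Definition link_length (v : V) : R := mdist (sender (L v)) (receiver (L v)).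

Definition cross_distance (w v : V) : R :=
  mdist (sender (L w)) (receiver (L v)).

Definition noise_margin (v : V) : R :=
  1 - beta * N * (link_length v `^ alpha) / power (L v).

Definition noise_coef (v : V) : R := beta / noise_margin v.

(* For w != v whose sender sits on the receiver of v, the formula divides by
   0; its intended value is min(1, +oo) = 1, whereas 0^-1 = 0 would make it 0. *)
Definition affectance (w v : V) : R :=
  if w == v then 0
  else if cross_distance w v == 0 then 1
  else Num.min 1 (noise_coef v * (power (L w) / power (L v)) *
                  ((link_length v / cross_distance w v) `^ alpha)).

Definition total_affectance (S : {set V}) (v : V) : R :=
  \sum_(w in S) affectance w v.

Definition Lambda_bound (t : R) : Prop :=
  forall S : {set V},
    (#|S|%:R / 4 : R) <= #|[set v in S | total_affectance S v <= 4 * t]|%:R.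

(* A minimum as soon as there is at least one link: Lambda_least below. *)
Definition Lambda : R := inf [set t | Lambda_bound t]%classic.

Lemma Lambda_bound_ge0 t : (0 < #|V|)%N -> Lambda_bound t -> 0 <= t.
Proof.
move=> /card_gt0P[v _] /(_ [set v]); rewrite cards1.
case: (boolP (total_affectance [set v] v <= 4 * t)) => [|/negPf vt].
  by rewrite /total_affectance big_set1 /affectance eqxx pmulr_rge0.
rewrite (_ : [set _ in _ | _] = finset.set0) ?cards0 => [|].
  by rewrite leNgt mul1r invr_gt0 ltr0n.
by apply/setP => w; rewrite !inE; case: eqP => // ->; rewrite vt.
Qed.

Lemma Lambda_least : (0 < #|V|)%N ->
  Lambda_bound Lambda /\ (forall t, Lambda_bound t -> Lambda <= t).
Proof.
move=> V0.
have lb : has_lbound [set t | Lambda_bound t]%classic.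
  by exists 0 => t /=; apply: Lambda_bound_ge0.
have hi : has_inf [set t | Lambda_bound t]%classic.
  split=> //; exists (#|V|%:R / 4) => S.
  rewrite (_ : [set _ in _ | _] = S); first by rewrite ler_piMr// invf_le1// ler1n.
  apply/setP => v; rewrite inE andb_idr// => _.
  rewrite mulrC divfK// -sum1_card natr_sum /total_affectance.
  rewrite big_mkcond/= ler_sum// => w _; rewrite /affectance.
  by case: ifP => // _; case: ifP => // _; case: ifP => // _; rewrite ge_min lexx.
split; last by move=> t Lt; apply: ge_inf.
move=> S; rewrite leNgt; apply/negP => failS.
pose bad v := (v \in S) && (4 * Lambda < total_affectance S v).
pose eps := \big[Num.min/1]_(v | bad v) (total_affectance S v - 4 * Lambda).
have eps0 : 0 < eps.
  by rewrite /eps; elim/big_ind: _ => // [x y x0 y0|v /andP[_]];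
    rewrite ?lt_min ?x0 ?subr_gt0.
have [|t Lt tlt] := @inf_adherent _ _ (eps / 4) _ hi; first by rewrite divr_gt0.
have := Lt S; rewrite leNgt => /negP; apply; apply: le_lt_trans failS.
rewrite ler_nat subset_leq_card//; apply/fintype.subsetP => v; rewrite !inE => /andP[vS vt].
rewrite vS/= leNgt; apply/negP => vL.
have : eps <= total_affectance S v - 4 * Lambda.
  by rewrite /eps (bigD1 v) /bad ?vS//= ge_min lexx.
rewrite lerBrDr leNgt => /negP; apply; apply: le_lt_trans vt _.
by rewrite -(ltr_pM2l (_ : 0 < 4 :> R))// mulrDr in tlt;
  rewrite addrC (lt_le_trans tlt)// (mulrC 4 (_ / _)) divfK.
Qed.

(* The links of S that succeed in a slot in which exactly S transmits. *)
Definition successful (S : {set V}) : {set V} :=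
  [set v in S | total_affectance S v <= 1].

(* One run of the algorithm, given the coins: coin v t is the outcome of the
   flip of v for slot t, used only if v has not yet succeeded. *)
Section Run.
Variable coin : V -> nat -> bool.

Definition transmitting (A : {set V}) (t : nat) : {set V} :=
  [set v in A | coin v t].

Fixpoint pending (t : nat) : {set V} :=
  if t is t'.+1 then
    pending t' :\: successful (transmitting (pending t') t')
  else [set: V].

Definition succeeds_in (t : nat) : {set V} :=
  successful (transmitting (pending t) t).

End Run.

End Affectance.

Section Schedule.
Context {R : realType}.
Variables (c3 : R) (n : nat).

Definition phase_prob (k : nat) : R := (4 * 2 ^+ k)^-1.

Definition phase_length (k : nat) : nat :=
  `|Num.ceil (8 * c3 * ln n%:R / phase_prob k)|%N.

(* (k, j): the current slot is the j-th one (from 0) of phase k.  A phase of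
   length 0, which for c3 > 0 occurs only when n <= 1, takes one slot here. *)
Definition next_slot (kj : nat * nat) : nat * nat :=
  let: (k, j) := kj in
  if (j.+1 < phase_length k)%N then (k, j.+1) else (k.+1, 0%N).

(* All senders start at slot 0, so those still running in slot t share the same
   loop counters. *)
Definition slot_prob (t : nat) : R :=
  phase_prob (iter t next_slot (0%N, 0%N)).1.

End Schedule.

Section Independence.
Context {d : measure_display} {T : measurableType d} {R : realType}.

Definition mutually_independent (P : probability T R) (I : choiceType)
    (E : I -> set T) : Prop :=
  (forall i, measurable (E i)) /\
  forall s : seq I, uniq s ->
    P (\bigcap_(i in [set` s]) E i)%classic = (\prod_(i <- s) P (E i))%E.

(* coin v t w: outcome, at sample point w, of the flip of v for slot t. *)
Definition independent_coins (P : probability T R) (V : finType)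
    (p : nat -> R) (coin : V -> nat -> T -> bool) : Prop :=
  mutually_independent P
    (fun i : V * nat => [set w | coin i.1 i.2 w]%classic) /\
  forall v t, P [set w | coin v t w]%classic = (p t)%:E.

End Independence.

(* Main.v *)
Require Import Defs.
From HB Require Import structures.
From mathcomp Require Import all_boot all_order all_algebra.
From mathcomp Require Import all_classical all_reals all_analysis.
From mathcomp Require Import lra ring.

Set Implicit Arguments.
Unset Strict Implicit.
Unset Printing Implicit Defensive.

Import Order.TTheory GRing.Theory Num.Theory.

Local Open Scope ring_scope.

(** While the slot probability q is at most 1 / (8 M), where M = max(1, Lambda),
    at least a quarter of the pending links v have affectance at most 4 M from
    the pending set, and each of them succeeds with probability at least
    q - q^2 (4 M) >= q / 2.  Hence the mean number of pending links shrinks by a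
    factor 1 - q / 8 per slot.  The first phase with q <= 1 / (8 M) has
    8 c3 (ln n) / q slots, so it leaves at most n^(1 - c3) pending links on
    average, and Markov's inequality applies; as phase lengths grow
    geometrically, it ends at time O(M log n).  Independence enters only through
    the law of the pending set, which is a Markov chain on subsets of V. *)

(** * Bernoulli weights of the set of heads in one slot *)

Section SlotWeight.
Context {R : realType} {V : finType}.
Implicit Types (p : R) (S U : {set V}).

Definition slot_weight p S : R := \prod_v (if v \in S then p else 1 - p).

Lemma slot_weight_ge0 p S : 0 <= p <= 1 -> 0 <= slot_weight p S.
Proof.
by case/andP=> p0 p1; apply: prodr_ge0 => v _; case: ifP; rewrite ?subr_ge0.
Qed.

(** Replacing the tails weight by 0 on [U] kills exactly the sets that miss a point of [U].
    Distributivity then turns the sum over sets into a product over links, with factor [p] on [U]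
    and 1 elsewhere. *)
Lemma sum_slot_weight_superset p U :
  \sum_(S : {set V} | U \subset S) slot_weight p S = p ^+ #|U|.
Proof.
transitivity (\prod_v (p + (if v \in U then 0 else 1 - p))); last first.
  rewrite -prodr_const [RHS]big_mkcond/=.
  by apply: eq_bigr => v _; case: ifP => _; rewrite ?addr0 // addrC subrK.
rewrite bigA_distr/= big_mkcond/=; apply: eq_bigr => S _.
case: (boolP (U \subset S)) => [/fintype.subsetP US|].
  apply: eq_bigr => v _; case: ifPn => // vS.
  by case: ifP => // /US; rewrite (negPf vS).
case/fintype.subsetPn => v vU vS.
by rewrite (bigD1 v)//= (negPf vS) vU mul0r.
Qed.

Lemma sum_slot_weight p : \sum_(S : {set V}) slot_weight p S = 1.
Proof.
rewrite -[RHS](expr0 p) -(@cards0 V) -sum_slot_weight_superset.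
by apply: eq_bigl => S; rewrite finset.sub0set.
Qed.

End SlotWeight.

(** * The Markov chain of pending sets and its drift *)

Section PendingChain.
Context {R : realType} {X : metricType R} {V : finType}.
Variables (alpha beta N : R) (L : V -> link X).
Implicit Types (A B S : {set V}) (p : nat -> R).

Local Notation aff := (affectance alpha beta N L).
Local Notation total := (total_affectance alpha beta N L).

(** Here [S] collects the heads of all links, finished ones included, so that its weight does not
    depend on [A]; the intersection recovers the actual transmitters. *)
Definition step A S : {set V} := A :\: successful alpha beta N L (A :&: S).

Lemma pendingS (coin : V -> nat -> bool) t :
  pending alpha beta N L coin t.+1 =
  step (pending alpha beta N L coin t) [set v | coin v t].
Proof.
rewrite /= /step /transmitting; congr (_ :\: successful _ _ _ _ _).
by apply/setP => v; rewrite !inE.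
Qed.

(** The law of the chain as a finite recursion, free of any probability space; [probability_pending]
    identifies it with the law of the actual run. *)
Fixpoint pending_law p t A : R :=
  if t is t'.+1 then
    \sum_B \sum_(S | step B S == A) pending_law p t' B * slot_weight (p t') S
  else (A == [set: V])%:R.

Definition pending_mean p t : R := \sum_A pending_law p t A * #|A|%:R.

Lemma pending_law_ge0 p t A :
  (forall s, 0 <= p s <= 1) -> 0 <= pending_law p t A.
Proof.
move=> p01; elim: t A => [|t IHt] A /=; first exact: ler0n.
by do 2![apply: sumr_ge0 => ? _]; rewrite mulr_ge0// slot_weight_ge0.
Qed.

(** Dual form of the forward recursion: once the sums are exchanged, each pair of [A] and [S] has
    the single target [step A S]. *)
Lemma pending_law_expectation p t (f : {set V} -> R) :
  \sum_A pending_law p t.+1 A * f A =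
  \sum_A pending_law p t A * \sum_S slot_weight (p t) S * f (step A S).
Proof.
under eq_bigr do rewrite /= mulr_suml.
rewrite exchange_big/=; apply: eq_bigr => A _.
under eq_bigr do rewrite mulr_suml big_mkcond/=.
rewrite exchange_big/= mulr_sumr; apply: eq_bigr => S _.
rewrite (bigD1 (step A S))//= eqxx big1 ?addr0 ?mulrA// => B /negPf.
by rewrite eq_sym => ->.
Qed.

Lemma sum_pending_law p t : \sum_A pending_law p t A = 1.
Proof.
elim: t => [|t IHt].
  rewrite (bigD1 [set: V])//= eqxx big1 ?addr0// => A /negPf.
  by move=> ->.
have := @pending_law_expectation p t (fun=> 1).
under eq_bigr do rewrite mulr1.
move=> ->; rewrite -[RHS]IHt; apply: eq_bigr => A _.
by under eq_bigr do rewrite mulr1; rewrite sum_slot_weight mulr1.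
Qed.

Lemma pending_mean0 p : pending_mean p 0 = #|V|%:R.
Proof.
rewrite /pending_mean (bigD1 [set: V])//= eqxx mul1r cardsT big1 ?addr0//.
by move=> A /negPf ->; rewrite mul0r.
Qed.

(** Markov's inequality: every nonempty pending set counts at least 1 in the mean. *)
Lemma pending_law_set0_ge p t : (forall s, 0 <= p s <= 1) ->
  1 - pending_mean p t <= pending_law p t finset.set0.
Proof.
move=> p01; rewrite lerBlDr -(sum_pending_law p t) (bigD1 finset.set0)//= lerD2l.
rewrite /pending_mean [leRHS](bigD1 finset.set0)//= cards0 mulr0 add0r.
apply: ler_sum => A A0; rewrite ler_peMr ?pending_law_ge0// ler1n.
by rewrite card_gt0.
Qed.

Section Drift.
Hypothesis aff_ge0 : forall w v, 0 <= aff w v.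

Lemma total_affectance_ge0 S v : 0 <= total S v.
Proof. by apply: sumr_ge0. Qed.

(* The indicator of the success of v is at least
   [v \in S] (1 - total affectance), whose mean is q - q^2 a_A(v) since v does
   not affect itself. *)
Lemma success_weight_ge (q : R) A v : 0 <= q <= 1 -> v \in A ->
  q - q ^+ 2 * total A v <=
  \sum_(S | v \in successful alpha beta N L (A :&: S)) slot_weight q S.
Proof.
move=> q01 vA.
have q1 : \sum_(S : {set V} | v \in S) slot_weight q S = q.
  rewrite -[RHS]expr1 -(cards1 v) -sum_slot_weight_superset.
  by apply: eq_bigl => S; rewrite finset.sub1set.
have q2 w : w != v ->
    \sum_(S : {set V} | (v \in S) && (w \in S)) slot_weight q S = q ^+ 2.
  move=> wv; have -> : 2%N = #|[set w; v]| by rewrite cards2 wv.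
  rewrite -sum_slot_weight_superset.
  by apply: eq_bigl => S; rewrite finset.subUset !finset.sub1set andbC.
have -> : q - q ^+ 2 * total A v =
    \sum_(S : {set V} | v \in S) slot_weight q S * (1 - total (A :&: S) v).
  under [RHS]eq_bigr do rewrite mulrBr mulr1.
  rewrite sumrB q1; congr (_ - _).
  rewrite /total_affectance mulr_sumr.
  under [RHS]eq_bigr do rewrite mulr_sumr.
  rewrite (exchange_big_dep (fun w => w \in A))/=; last first.
    by move=> S w _; rewrite inE => /andP[].
  apply: eq_bigr => w wA.
  have [->|wv] := eqVneq w v.
    rewrite /affectance eqxx mulr0 big1// => S _; exact: mulr0.
  rewrite -mulr_suml -(q2 _ wv); congr (_ * _).
  by apply: eq_bigl => S; rewrite inE wA.
rewrite big_mkcond [leRHS]big_mkcond/=; apply: ler_sum => S _.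
have w0 : 0 <= slot_weight q S by exact: slot_weight_ge0.
have t0 := total_affectance_ge0 (A :&: S) v.
rewrite !inE vA/=; case: ifP => _ //=.
case: ifPn => [_|]; first by rewrite ler_piMr// lerBlDr lerDl.
by rewrite -ltNge => /ltW t1; rewrite mulr_ge0_le0// subr_le0.
Qed.

Lemma drift_step (q M : R) A : Lambda_bound alpha beta N L M ->
  0 <= q <= 1 -> 8 * M * q <= 1 ->
  \sum_S slot_weight q S * #|step A S|%:R <= (1 - q / 8) * #|A|%:R.
Proof.
move=> LM q01 qM; have q0 : 0 <= q by case/andP: q01.
have card_step S : #|step A S|%:R =
    #|A|%:R - \sum_(v in A) (v \in successful alpha beta N L (A :&: S))%:R :> R.
  have sub : successful alpha beta N L (A :&: S) \subset A.
    by apply/fintype.subsetP => v; rewrite !inE => /andP[/andP[]].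
  rewrite /step cardsD (finset.setIidPr sub) natrB ?subset_leq_card//; congr (_ - _).
  under [RHS]eq_bigr do rewrite mulrb.
  rewrite -sum1_card natr_sum -big_mkcondr/=; apply: eq_bigl => v.
  by rewrite andb_idl// => /(fintype.subsetP sub).
under eq_bigr do rewrite card_step mulrBr mulr_sumr.
rewrite sumrB -mulr_suml sum_slot_weight mul1r mulrBl mul1r lerB//.
rewrite exchange_big/=.
pose good := [set v in A | total A v <= 4 * M].
have goodA : good \subset A by apply/fintype.subsetP => v; rewrite inE => /andP[].
(* Only good links are credited, each with [q / 2]; since they form a quarter of [A], the total is
   at least [q / 8] times the size of [A]. *)
apply: (@le_trans _ _ (\sum_(v in good) q / 2)).
  rewrite sumr_const -[leRHS]mulr_natr; have := LM A; rewrite -/good.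
  move: #|A|%:R #|good|%:R => a g ag; nra.
rewrite [leRHS](big_setID good)/= (finset.setIidPr goodA) -[leLHS]addr0 lerD//; last first.
  by do 2![apply: sumr_ge0 => ? _]; rewrite mulr_ge0// slot_weight_ge0.
apply: ler_sum => v; rewrite inE => /andP[vA vM].
have := @success_weight_ge q A v q01 vA.
under [X in _ -> _ <= X]eq_bigr do rewrite mulr_natr mulrb.
rewrite -big_mkcond/=; apply: le_trans; nra.
Qed.

Lemma pending_mean_drift p (M : R) t : Lambda_bound alpha beta N L M ->
  (forall s, 0 <= p s <= 1) -> 8 * M * p t <= 1 ->
  pending_mean p t.+1 <= (1 - p t / 8) * pending_mean p t.
Proof.
move=> LM p01 pM; rewrite /pending_mean pending_law_expectation mulr_sumr.
apply: ler_sum => A _; rewrite mulrCA ler_wpM2l ?pending_law_ge0//.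
exact: drift_step.
Qed.

End Drift.

(** Pending sets only shrink, whatever the slot probability. This covers the slots before and after
    the phase in which the drift is exploited. *)
Lemma pending_mean_le p s t : (forall s, 0 <= p s <= 1) -> (s <= t)%N ->
  pending_mean p t <= pending_mean p s.
Proof.
move=> p01; elim: t => [|t IHt]; first by rewrite leqn0 => /eqP->.
rewrite leq_eqVlt => /predU1P[->//|/IHt]; apply: le_trans.
rewrite /pending_mean pending_law_expectation.
apply: ler_sum => A _; rewrite ler_wpM2l ?pending_law_ge0//.
rewrite [leRHS](_ : _ = (\sum_(S : {set V}) slot_weight (p t) S) * #|A|%:R); last first.
  by rewrite sum_slot_weight mul1r.
rewrite mulr_suml; apply: ler_sum => S _.
by rewrite ler_wpM2l ?slot_weight_ge0// ler_nat subset_leq_card// finset.subsetDl.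
Qed.

End PendingChain.

(** * From independent coins to the law of the pending set *)

Section Literals.
Context {R : realType} {V : finType} {d : measure_display} {T : measurableType d}.
Variables (P : probability T R) (p : nat -> R) (coin : V -> nat -> T -> bool).
Hypothesis coins : independent_coins P p coin.
Implicit Types (s : seq (V * nat)) (eps : V * nat -> bool).

(** Cylinder events, which prescribe the outcomes of finitely many coins. *)
Definition literals eps s : set T :=
  [set w | all (fun i => coin i.1 i.2 w == eps i) s]%classic.

Definition literal_weight (b : bool) t : R := if b then p t else 1 - p t.

Lemma measurable_literals eps s : measurable (literals eps s).
Proof.
case: coins => -[mE _] _; elim: s => [|i s IHs].
  by rewrite (_ : literals eps [::] = setT)//; apply/seteqP; split.
rewrite (_ : literals eps (i :: s) =
  (if eps i then [set w | coin i.1 i.2 w] else ~` [set w | coin i.1 i.2 w])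
    `&` literals eps s)%classic.
  by apply: measurableI => //; case: ifP => _; [|apply: measurableC]; apply: mE.
apply/seteqP; split => w /=; rewrite /literals/=.
  by case/andP => /eqP <- ->; split => //; case: ifP => //= ->.
by case=> + ->; case: (eps i) => [->|/negP/negPf ->].
Qed.

(* Negative literals are eliminated one at a time by P (A \ E) = P A - P (A & E). *)
Lemma probability_literals eps s : uniq s ->
  P (literals eps s) = (\prod_(i <- s) literal_weight (eps i) i.2)%:E.
Proof.
case: (coins) => -[mE indE] pE.
(* The list [r] accumulates coins required to show heads. When [s] is exhausted only positive events
   remain, and the independence hypothesis applies directly. *)
suff gen r : uniq (r ++ s) -> P (literals xpredT r `&` literals eps s)%classic =
    ((\prod_(i <- r) p i.2) * (\prod_(i <- s) literal_weight (eps i) i.2))%:E.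
  move=> us; have := gen [::] us; rewrite big_nil mul1r => <-; congr (P _).
  by apply/seteqP; split => w //= [].
elim: s r => [|i s IHs] r.
  rewrite cats0 big_nil mulr1 => ur; transitivity (\prod_(i <- r) (p i.2)%:E)%E.
    under [RHS]eq_bigr => i _ do rewrite -(pE i.1 i.2).
    rewrite -indE//; congr (P _); apply/seteqP; split => w /=.
      by case=> /allP rw _ i /rw /eqP.
    by move=> rw; split => //; apply/allP => i /rw /= ->.
  by rewrite prodEFin.
move=> u; have ui : uniq ((i :: r) ++ s) by move: u; rewrite -cat1s uniq_catCA.
have us : uniq (r ++ s) by move: ui => /= /andP[].
have mrs : measurable (literals xpredT r `&` literals eps s)%classic.
  by apply: measurableI; apply: measurable_literals.
have irs : (literals xpredT (i :: r) `&` literals eps s =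
  (literals xpredT r `&` literals eps s) `&` [set w | coin i.1 i.2 w])%classic.
  apply/seteqP; split => w /=; rewrite /literals/= eqb_id.
    by case=> /andP[-> ->] ->.
  by case=> -[-> ->] ->.
rewrite big_cons; have [ei|ei] := boolP (eps i).
  rewrite mulrCA mulrA -[p _ * _](big_cons _ _ i r xpredT (fun i => p i.2)).
  rewrite -IHs// irs; congr (P _).
  by apply/seteqP; split => w /=; rewrite /literals/= ei eqb_id;
    [case=> -> /andP[-> ->]|case=> -[-> ->] ->].
rewrite (_ : _ `&` _ = (literals xpredT r `&` literals eps s) `\`
   [set w | coin i.1 i.2 w])%classic; last first.
  apply/seteqP; split => w /=; rewrite /literals/= (negPf ei) eqbF_neg.
    by case=> -> /andP[/negP ? ->].
  by case=> -[-> ->] /negP ->.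
have PD A B : measurable A -> measurable B ->
    P (A `\` B)%classic = (P A - P (A `&` B)%classic)%E.
  by move=> mA mB; rewrite measureD// ltey_eq fin_num_measure.
rewrite (PD _ _ mrs (mE i)) -irs !IHs// big_cons -EFinB /literal_weight.
by congr (_%:E); ring.
Qed.

Lemma measure_partition (F : finType) (f : T -> F) (A : set T) :
  measurable A -> (forall x, measurable [set w | f w = x]%classic) ->
  P A = (\sum_(x : F) P (A `&` [set w | f w = x])%classic)%E.
Proof.
move=> mA mf; rewrite fsbig_seq ?index_enum_uniq//.
rewrite -measure_fin_bigcup//.
- congr (P _); apply/seteqP; split => w /=; last by case=> x _ [].
  by move=> Aw; exists (f w) => //=; rewrite mem_index_enum.
- apply/trivIsetP => x y _ _ /eqP xy; apply/seteqP; split => w //= [[_ fx] [_ fy]].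
  by apply: xy; rewrite -fx -fy.
- by move=> x _; apply: measurableI.
Qed.

Variables (X : metricType R) (alpha beta N : R) (L : V -> link X).

Local Notation pend t w := (pending alpha beta N L (fun u r => coin u r w) t).

Definition heads t w : {set V} := [set v | coin v t w].

Let slot t : seq (V * nat) := [seq (v, t) | v <- index_enum V].

Let pending_heads t w : pend t.+1 w = step alpha beta N L (pend t w) (heads t w).
Proof. exact: pendingS. Qed.

Let slot_literals t S :
  [set w | heads t w = S]%classic =
  literals (fun i => i.1 \in S) (slot t).
Proof.
apply/seteqP; split => w /=.
  by move=> <-; apply/allP => _ /mapP[v _ ->] /=; rewrite inE.
move=> /allP wS; apply/setP => v; rewrite inE; apply/eqP.
by apply: (wS (v, t)); rewrite map_f// mem_index_enum.
Qed.

Lemma measurable_pending t A : measurable [set w | pend t w = A]%classic.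
Proof.
elim: t A => [|t IHt] A.
  have [->|/eqP TA] := eqVneq A [set: V].
    by rewrite (_ : mkset _ = setT)//; apply/seteqP; split.
  by rewrite (_ : mkset _ = set0)//; apply/seteqP; split => // w /= /esym.
(* The set [A] is reached from finitely many pairs of a pending set and a set of heads, so the event
   is a finite union. *)
rewrite (_ : mkset _ = \big[setU/set0]_(BS : {set V} * {set V} |
    step alpha beta N L BS.1 BS.2 == A)
    ([set w | pend t w = BS.1] `&` [set w | heads t w = BS.2]))%classic.
  apply: bigsetU_measurable => BS _; apply: measurableI => //.
  by rewrite slot_literals; apply: measurable_literals.
rewrite -bigcup_seq_cond; apply/seteqP; split => w /=.
  rewrite -[X in X = A]/(pend t.+1 w) pending_heads => pA.
  by exists (pend t w, heads t w) => //=; rewrite mem_index_enum pA eqxx.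
by case=> -[B S] /= /andP[_ /eqP BS] [pB pS]; rewrite -BS -pS -pB -pending_heads.
Qed.

(** The pending set at [t] is determined by earlier coins, hence independent of those from slot [t]
    on. Carrying arbitrary later literals lets the induction absorb the coins of one more slot. *)
Lemma pending_law_literals t A eps s : uniq s ->
  (forall i, i \in s -> (t <= i.2)%N) ->
  P ([set w | pend t w = A] `&` literals eps s)%classic =
  (pending_law alpha beta N L p t A *
   \prod_(i <- s) literal_weight (eps i) i.2)%:E.
Proof.
elim: t A eps s => [|t IHt] A eps s us ts.
  rewrite /=; have [->|/eqP TA] := eqVneq A [set: V].
    rewrite mul1r -probability_literals//; congr (P _).
    by apply/seteqP; split => w //= [].
  rewrite mul0r (_ : _ `&` _ = set0)%classic ?measure0//.
  by apply/seteqP; split => // w /= [/esym].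
have mA : measurable ([set w | pend t.+1 w = A] `&` literals eps s)%classic.
  by apply: measurableI; [apply: measurable_pending|apply: measurable_literals].
rewrite (@measure_partition _ (fun w => (pend t w, heads t w)))//; last first.
  move=> -[B S]; rewrite (_ : mkset _ = [set w | pend t w = B] `&`
     [set w | heads t w = S])%classic.
    apply: measurableI; first exact: measurable_pending.
    by rewrite slot_literals; apply: measurable_literals.
  by apply/seteqP; split => w /= [-> ->].
rewrite (eq_bigr (fun BS => ((if step alpha beta N L BS.1 BS.2 == A then
    pending_law alpha beta N L p t BS.1 * slot_weight (p t) BS.2 else 0) *
    \prod_(i <- s) literal_weight (eps i) i.2)%:E)).
  rewrite sumEFin -mulr_suml -(pair_bigA _ (fun B S => if step _ _ _ _ B S == A then
    _ p t B * slot_weight (p t) S else 0))/=.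
  by under eq_bigr do rewrite -big_mkcond.
move=> -[B S] _ /=; case: ifPn => [/eqP BSA|/eqP BSA]; last first.
  rewrite mul0r (_ : _ `&` _ = set0)%classic ?measure0//.
  apply/seteqP; split => // w /= [[+ _] [pB pS]].
  by rewrite -[X in X = A]/(pend t.+1 w) pending_heads pB pS.
(* The coins in [s] belong to slots after [t], so prescribing the pattern [S] on slot [t] cannot
   clash with [eps], and the induction hypothesis applies to the joined list. *)
pose eps' (i : V * nat) := if i.2 == t then i.1 \in S else eps i.
have s_t i : i \in s -> (i.2 == t) = false by move=> /ts; case: ltngtP.
have st_uniq : uniq (slot t ++ s).
  rewrite cat_uniq us map_inj_uniq ?index_enum_uniq ?andbT; last by move=> u v [].
  by apply/hasPn => i /s_t ti; apply/negP => /mapP[v _ iv]; rewrite iv eqxx in ti.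
rewrite (_ : _ `&` _ = [set w | pend t w = B] `&` literals eps' (slot t ++ s))%classic.
  rewrite IHt//; last first.
    by move=> i; rewrite mem_cat => /orP[/mapP[v _ ->]//|/ts /ltnW].
  rewrite big_cat/= mulrA; congr (_ * _ * _)%:E.
    rewrite /slot big_map /slot_weight; apply: eq_bigr => v _.
    by rewrite /eps'/= eqxx.
  by apply: eq_big_seq => i /s_t ti; rewrite /eps' ti.
have eps'E w : all (fun i => coin i.1 i.2 w == eps' i) (slot t ++ s) =
   all (fun i => coin i.1 i.2 w == (i.1 \in S)) (slot t) &&
   all (fun i => coin i.1 i.2 w == eps i) s.
  rewrite all_cat; congr (_ && _).
    by rewrite !all_map; apply: eq_all => v /=; rewrite /eps' /= eqxx.
  by apply: eq_in_all => i /s_t ti; rewrite /eps' ti.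
apply/seteqP; split => w.
  case=> -[_ ws] [pB pS]; split => //; rewrite /literals/= eps'E; apply/andP; split => //.
  by have : [set w | heads t w = S]%classic w by []; rewrite slot_literals.
case=> pB; rewrite /literals/= eps'E => /andP[wt ws].
have wS : heads t w = S.
  by have : literals (fun i => i.1 \in S) (slot t) w by []; rewrite -slot_literals.
split; last by rewrite /= wS pB.
by split => //; rewrite /= -BSA -pB -wS -pending_heads.
Qed.

Lemma probability_pending t A :
  P [set w | pend t w = A]%classic = (pending_law alpha beta N L p t A)%:E.
Proof.
have := @pending_law_literals t A xpredT [::] isT.
rewrite big_nil mulr1 => <-//; congr (P _).
by apply/seteqP; split => w //= [].
Qed.

End Literals.

(** * Phases laid end to end *)

Section Phases.
Context {R : realType}.
Variables (c3 : R) (n : nat).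
Hypothesis phase_length_gt0 : forall k, (0 < phase_length c3 n k)%N.

Definition phase_start k : nat := \sum_(i < k) phase_length c3 n i.

Lemma phase_startS k : phase_start k.+1 = (phase_start k + phase_length c3 n k)%N.
Proof. by rewrite /phase_start big_ord_recr. Qed.

Lemma iter_next_slot k j : (j < phase_length c3 n k)%N ->
  iter (phase_start k + j) (next_slot c3 n) (0, 0)%N = (k, j).
Proof.
elim: k j => [|k IHk]; elim=> [|j IHj] lt_j.
- by rewrite /phase_start big_ord0.
- by rewrite addnS iterS IHj ?(ltnW lt_j)//= lt_j.
(* The first slot of a phase succeeds the last slot of the previous phase, whose index is its length
   minus one. *)
- rewrite addn0 phase_startS -(prednK (phase_length_gt0 k)) addnS iterS IHk.
    by rewrite /= prednK// ltnn.
  by rewrite prednK.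
- by rewrite addnS iterS IHj ?(ltnW lt_j)//= lt_j.
Qed.

Lemma slot_prob_phase k j : (j < phase_length c3 n k)%N ->
  slot_prob c3 n (phase_start k + j) = phase_prob k.
Proof. by move=> lt_j; rewrite /slot_prob iter_next_slot. Qed.

End Phases.

(** * Facts on affectance, pending links and [Lambda] *)

Lemma affectance_ge0 (R : realType) (X : metricType R) (V : finType)
    (alpha beta N : R) (L : V -> link X) :
  0 <= beta -> (forall v, 0 < power (L v)) ->
  (forall v, 0 < noise_margin alpha beta N L v) ->
  forall w v, 0 <= affectance alpha beta N L w v.
Proof.
move=> beta0 pow0 margin0 w v; rewrite /affectance; case: ifP => // _.
case: ifP => // _; rewrite le_min ler01/= mulr_ge0 ?powR_ge0//.
by rewrite mulr_ge0// divr_ge0// ltW.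
Qed.

Lemma notin_pending (R : realType) (X : metricType R) (V : finType)
    (alpha beta N : R) (L : V -> link X) (coin : V -> nat -> bool) t v :
  v \notin pending alpha beta N L coin t <->
  exists2 s, (s < t)%N & v \in succeeds_in alpha beta N L coin s.
Proof.
elim: t => [|t IHt]; first by rewrite inE; split => // -[].
rewrite /= finset.in_setD negb_and negbK; split.
  case/orP => [vt|/IHt[s st vs]]; first by exists t.
  by exists s => //; apply: ltnW.
case=> s; rewrite ltnS leq_eqVlt => /predU1P[->|st] vs; first by rewrite vs.
by apply/orP; right; apply/IHt; exists s.
Qed.

(** [Lambda_bound] is upward closed, so the attained minimum may be raised to 1. *)
Lemma Lambda_bound_max1 (R : realType) (X : metricType R) (V : finType)
    (alpha beta N : R) (L : V -> link X) : (0 < #|V|)%N ->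
  Lambda_bound alpha beta N L (Num.max 1 (Lambda alpha beta N L)).
Proof.
move=> /(Lambda_least alpha beta N L)[LL _] S; apply: le_trans (LL S) _.
rewrite ler_nat subset_leq_card//; apply/fintype.subsetP => v.
rewrite !inE => /andP[-> /le_trans]; apply.
by rewrite ler_pM2l// le_max lexx orbT.
Qed.

(** * Numerical estimates for the schedule *)

(** Apply ln (1 + x) <= x at x = 1/n - 1. The bound serves to absorb rounding terms into multiples
    of the logarithm. *)
Lemma ln_nat_ge (R : realType) (n : nat) : (1 < n)%N -> 1 / 2 <= ln n%:R :> R.
Proof.
move=> n1; have n0 : (0 : R) < n%:R by rewrite ltr0n (ltn_trans _ n1).
have nV : n%:R^-1 <= 1 / 2 :> R by rewrite mul1r lef_pV2 ?posrE// ler_nat.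
have nV0 : (0 : R) < n%:R^-1 by rewrite invr_gt0.
have /le_ln1Dx : -1 < n%:R^-1 - 1 :> R by lra.
by rewrite addrCA subrr addr0 lnV ?posrE//; lra.
Qed.

Lemma phase_prob_gt0 (R : realType) k : 0 < phase_prob k :> R.
Proof. by rewrite /phase_prob invr_gt0 mulr_gt0// exprn_gt0. Qed.

Lemma phase_prob_le1 (R : realType) k : phase_prob k <= 1 :> R.
Proof.
rewrite /phase_prob invf_le1 ?mulr_gt0 ?exprn_gt0//.
have : 1 <= 2 ^+ k :> R by rewrite exprn_ege1// ler1n.
lra.
Qed.

Lemma slot_prob_itv (R : realType) (c3 : R) n t : 0 <= slot_prob c3 n t <= 1.
Proof. by rewrite phase_prob_le1 ltW// phase_prob_gt0. Qed.

Lemma phase_length_itv (R : realType) (c3 : R) n k : 0 <= c3 -> (0 < n)%N ->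
  8 * c3 * ln n%:R / phase_prob k <= (phase_length c3 n k)%:R <
  8 * c3 * ln n%:R / phase_prob k + 1.
Proof.
move=> c30 n0; rewrite /phase_length; set x := _ / _.
have x0 : 0 <= x.
  by rewrite divr_ge0 ?(ltW (phase_prob_gt0 _ _))// mulr_ge0 ?ln_ge0 ?ler1n// mulr_ge0.
have -> : `|Num.ceil x|%N%:R = (Num.ceil x)%:~R :> R.
  by rewrite natr_absz ger0_norm// ceil_ge0 (lt_le_trans _ x0)// ltrN10.
by rewrite ceil_ge/= -ltrBlDr -[X in _ - X]/(1%:~R) -intrB ceilB1_lt.
Qed.

Lemma phase_start_le (R : realType) (c3 : R) n k : 0 <= c3 -> (0 < n)%N ->
  (phase_start c3 n k)%:R <= (32 * c3 * ln n%:R + 1) * 2 ^+ k.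
Proof.
move=> c30 n0; elim: k => [|k IHk].
  rewrite /phase_start big_ord0 expr0 mulr1 addr_ge0// mulr_ge0 ?mulr_ge0//.
  by rewrite ln_ge0 ?ler1n.
rewrite phase_startS natrD exprS.
have /andP[_ /ltW] := phase_length_itv k c30 n0.
rewrite /phase_prob invrK.
(* The 1 lost to the ceiling is at most [2 ^+ k], so the bound exactly doubles. *)
have : 1 <= 2 ^+ k :> R by rewrite exprn_ege1// ler1n.
by nra.
Qed.

(** The least exponent reaching 2 M overshoots by less than a factor 2. For this phase the slot
    probability lies between 1 / (16 M) and 1 / (8 M). *)
Lemma dyadic_approx (R : realType) (M : R) : 1 <= M ->
  exists k : nat, 2 * M <= 2 ^+ k <= 4 * M.
Proof.
move=> M1; have ex : exists k : nat, 2 * M <= 2 ^+ k.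
  exists (Num.truncn (2 * M)).+1; apply: le_trans (ltW (truncnS_gt _)) _.
  by rewrite -natrX ler_nat ltnW// ltn_expl.
have [[|k] Mk min_k] := ex_minnP ex; first by exists 0%N; rewrite Mk/=; lra.
exists k.+1; rewrite Mk/= exprS.
have : 2 ^+ k < 2 * M by rewrite ltNge; apply/negP => /min_k; rewrite ltnn.
lra.
Qed.

(** * The decisive phase and the conclusion *)

Lemma pending_mean_phase (R : realType) (X : metricType R) (V : finType)
    (alpha beta N : R) (L : V -> link X) (M c3 : R) k :
  (forall w v, 0 <= affectance alpha beta N L w v) ->
  Lambda_bound alpha beta N L M -> 8 * M * phase_prob k <= 1 ->
  0 < c3 -> (1 < #|V|)%N ->
  pending_mean alpha beta N L (slot_prob c3 #|V|) (phase_start c3 #|V| k.+1) <=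
  #|V|%:R `^ (1 - c3).
Proof.
move=> aff0 LM Mk c30 V1; set p := slot_prob c3 #|V|; set n := #|V| in V1 *.
have ln0 : 0 < ln n%:R :> R by rewrite ln_gt0// ltr1n.
have V0 : (0 < n)%N by exact: ltnW.
have p01 t : 0 <= p t <= 1 by exact: slot_prob_itv.
have q0 := phase_prob_gt0 R k; have q1 := phase_prob_le1 R k.
have len0 i : (0 < phase_length c3 n i)%N.
  have /andP[+ _] := phase_length_itv i (ltW c30) V0.
  rewrite -(ltr0n R); apply: lt_le_trans.
  by rewrite divr_gt0 ?phase_prob_gt0// !mulr_gt0.
pose e := pending_mean alpha beta N L p.
have decay j : (j <= phase_length c3 n k)%N ->
    e (phase_start c3 n k + j)%N <= (1 - phase_prob k / 8) ^+ j * n%:R.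
  elim: j => [_|j IHj jk].
    rewrite addn0 expr0 mul1r; apply: le_trans (pending_mean_le _ _ _ _ p01 (leq0n _)) _.
    by rewrite pending_mean0.
  rewrite addnS exprS -mulrA.
  have pk : p (phase_start c3 n k + j)%N = phase_prob k by exact: slot_prob_phase.
  apply: le_trans (pending_mean_drift aff0 LM p01 _) _; rewrite pk//.
  by rewrite ler_wpM2l ?IHj ?(ltnW jk)//; lra.
rewrite phase_startS; apply: le_trans (decay _ (leqnn _)) _.
have n0 : (0 : R) < n%:R by rewrite ltr0n.
(* With the factor n cancelled, it remains to bound the decay by exp (- c3 ln n): use 1 - x <= exp
   (- x) with x = q / 8, over at least 8 c3 (ln n) / q slots. *)
rewrite /powR (gt_eqF n0) mulrBl mul1r expRD lnK ?posrE// mulrC ler_pM2l//.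
apply: (@le_trans _ _ (expR (- (phase_prob k / 8)) ^+ phase_length c3 n k)).
  rewrite lerXn2r ?nnegrE ?expR_ge0//; first lra.
  by rewrite (le_trans _ (expR_ge1Dx _)).
rewrite -expRM_natr ler_expR mulNr lerN2.
have /andP[+ _] := phase_length_itv k (ltW c30) V0.
rewrite ler_pdivrMr//; lra.
Qed.

Theorem theorem3 (R : realType) (gamma : R) (gamma_gt0 : 0 < gamma) :
  exists2 c0 : R, 0 < c0 & forall c3 : R, c0 <= c3 ->
  exists2 C : R, 0 < C &
  forall (X : metricType R) (alpha beta N : R)
    (V : finType) (L : V -> link X)
    (d : measure_display) (T : measurableType d) (P : probability T R)
    (coin : V -> nat -> T -> bool),
  0 < alpha -> 1 <= beta -> 0 <= N ->
  (forall v, 0 < power (L v)) ->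
  (forall v, 0 < noise_margin alpha beta N L v) ->
  independent_coins P (slot_prob c3 #|V|) coin ->
  ((1 - #|V|%:R `^ (- gamma))%R%:E <=
   P [set w | forall v : V, exists2 t : nat,
        (t.+1%:R <= C * Num.max 1 (Lambda alpha beta N L) * ln #|V|%:R)%R &
        v \in succeeds_in alpha beta N L (fun u s => coin u s w) t]%classic)%E.
Proof.
(* This threshold makes n^(1 - c3) at most n^(- gamma). *)
exists (1 + gamma); first lra.
(* With l = ln n and 2^k <= 4 M, phase k ends by (32 c3 l + 1) 8 M = 256 c3 l M + 8 M, and 8 M <= 16
   l M because l >= 1/2. *)
move=> c3 c3_ge; exists (256 * c3 + 16); first lra.
move=> X alpha beta N V L d T P coin _ beta1 _ pow0 margin0 coins.
have aff0 := affectance_ge0 (le_trans ler01 beta1) pow0 margin0.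
have c30 : 0 < c3 by lra.
set M := Num.max 1 _; set bound := _ * M * _.
have M1 : 1 <= M by rewrite le_max lexx.
have bound0 : 0 <= bound.
  rewrite /bound mulr_ge0 ?mulr_ge0//; [lra|lra|].
  (* For empty [V], [ln] takes its default value 0. *)
  by case: #|V| => [|n]; [rewrite ln0|rewrite ln_ge0// ler1n].
(* Success in slot t counts as time t + 1, so meeting the real bound means t lies strictly below its
   integer part. *)
rewrite (_ : mkset _ = [set w | pending alpha beta N L (fun u s => coin u s w)
    (Num.truncn bound) = finset.set0])%classic; last first.
  apply/seteqP; split => w /=.
    move=> wV; apply/setP => v; rewrite inE; apply/negbTE/notin_pending.
    by have [t tb vt] := wV v; exists t => //; rewrite truncn_ge_nat.
  move=> w0 v; have : v \notin pending alpha beta N L (fun u s => coin u s w)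
    (Num.truncn bound) by rewrite w0 inE.
  by case/notin_pending => t; rewrite truncn_ge_nat//; exists t.
rewrite (probability_pending coins) lee_fin.
have p01 t := slot_prob_itv c3 #|V| t.
apply: le_trans (pending_law_set0_ge _ _ _ _ _ p01); rewrite lerD2l lerN2.
(* The logarithm vanishes here and no slot is available: one link makes the allowed failure
   probability 1, and no link makes the initial mean 0. *)
have [V1|V1] := leqP #|V| 1.
  apply: le_trans (pending_mean_le _ _ _ _ p01 (leq0n _)) _.
  rewrite pending_mean0; case: #|V| V1 => [|[|]]// _; last by rewrite powR1.
  exact: powR_ge0.
have [k /andP[k_ge k_le]] := dyadic_approx M1.
have V0 : (0 < #|V|)%N by exact: ltnW.
have start_le : (phase_start c3 #|V| k.+1 <= Num.truncn bound)%N.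
  rewrite truncn_ge_nat//; apply: le_trans (phase_start_le k.+1 (ltW c30) V0) _.
  rewrite /bound exprS.
  have lnV := ln_nat_ge R V1.
  set l := ln _ in lnV *.
  have : (32 * c3 * l + 1) * 2 ^+ k <= (32 * c3 * l + 1) * (4 * M).
    by rewrite ler_wpM2l//; nra.
  have : M <= 2 * l * M by nra.
  nra.
apply: le_trans (pending_mean_le _ _ _ _ p01 start_le) _.
apply: le_trans (pending_mean_phase aff0 (Lambda_bound_max1 _ _ _ _ V0) _ c30 V1) _.
  rewrite -/M /phase_prob ler_pdivrMr ?mulr_gt0 ?exprn_gt0//; lra.
by rewrite ler_powR ?ler1n//; lra.
Qed.
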